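(* Let $k,m,n\ge1$ and for $1\le i\le n$ let $a^i_1,\dots,a^i_m\subseteq[k]$. Then in $\mathrm{Sym}^m\langle P[k]\rangle$, $$\bigcup_{i=1}^n\{a^i_1,\dots,a^i_m\}=\frac{1}{(m!)^{n-1}}\sum_{\sigma\in\{\mathrm{id}\}\times S_m^{n-1}}\Big\{\bigcup_{i=1}^n a^i_{\sigma_i(1)},\dots,\bigcup_{i=1}^n a^i_{\sigma_i(m)}\Big\},$$ where $\sigma=(\sigma_1,\dots,\sigma_n)$ with $\sigma_1=\mathrm{id}$ and $\sigma_2,\dots,\sigma_n\in S_m$.
   Context: Work over $\mathbb{R}$. $[k]=\{1,\dots,k\}$; $\langle P[k]\rangle$ is the real vector space with basis the subsets of $[k]$, with union the bilinear extension of set union. $\langle P[k]\rangle^{\otimes m}$ has componentwise union, and $S_m$ acts by permuting tensor factors. $\mathrm{Sym}^m\langle P[k]\rangle=\langle P[k]\rangle^{\otimes m}/S_m$ is the coinvariant space (quotient by the span of $\tau v-v$), and $\{a_1,\dots,a_m\}$ denotes the class of $a_1\otimes\cdots\otimes a_m$. Union on $\mathrm{Sym}^m\langle P[k]\rangle$ is $\bar u\cup\bar v=\frac{1}{m!}\sum_{\tau\in S_m}\overline{u\cup\tau v}$, and $\bigcup_{i=1}^n$ denotes the iterated union $(\cdots(x_1\cup x_2)\cup\cdots)\cup x_n$. *)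

(* Defs.v *)
From HB Require Import structures.
From mathcomp Require Import all_boot all_order all_fingroup all_algebra.
From mathcomp Require Import generic_quotient ring_quotient.
From mathcomp Require Import reals.

Set Implicit Arguments.
Unset Strict Implicit.
Unset Printing Implicit Defensive.

Import GRing.Theory.
Local Open Scope ring_scope.
Local Open Scope quotient_scope.

Section PowerSetSpace.
Variables (R : realType) (k : nat).

Definition PS := {ffun {set 'I_k} -> R^o}.

Definition psb (a : {set 'I_k}) : PS := [ffun b => (b == a)%:R].

Definition psU (u v : PS) : PS :=
  \sum_(a : {set 'I_k}) \sum_(b : {set 'I_k}) (u a * v b) *: psb (a :|: b).

End PowerSetSpace.

Section TensorPower.
Variables (R : realType) (m k : nat).

(* The m-th tensor power of [PS R k], in coordinates with respect to the basis
   a_1 ⊗ ... ⊗ a_m, where (a_1, ..., a_m) runs over the m-tuples of subsets. *)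
Definition tidx := {ffun 'I_m -> {set 'I_k}}.
Definition TP := {ffun tidx -> R^o}.

Definition tpb (a : tidx) : TP := [ffun b => (b == a)%:R].

Definition tens (u : 'I_m -> PS R k) : TP := [ffun a : tidx => \prod_j u j (a j)].

Definition tpU (u v : TP) : TP :=
  \sum_(a : tidx) \sum_(b : tidx) (u a * v b) *: tpb [ffun j => a j :|: b j].

(* In coordinates; on pure tensors see [tact_tens]. *)
Definition tact (t : 'S_m) (v : TP) : TP := [ffun a : tidx => v [ffun j => a (t j)]].

Lemma tens_psb (a : 'I_m -> {set 'I_k}) :
  tens (fun j => psb R (a j)) = tpb [ffun j => a j].
Proof.
apply/ffunP=> b; rewrite !ffunE; case: eqP => [->|neq].
  by rewrite big1 // => j _; rewrite !ffunE eqxx.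
suff [j nj] : exists j, b j != a j.
  by rewrite (bigD1 j) //= ffunE (negPf nj) mul0r.
apply/existsP; apply: contra_notT neq; rewrite negb_exists => /forallP h.
by apply/ffunP=> j; rewrite ffunE; apply/eqP; have := h j; rewrite negbK.
Qed.

Lemma tpUE u v c : tpU u v c =
  \sum_(a : tidx) \sum_(b : tidx) u a * v b * ([forall j, c j == a j :|: b j])%:R.
Proof.
rewrite sum_ffunE; apply: eq_bigr => a _; rewrite sum_ffunE.
apply: eq_bigr => b _; rewrite !ffunE; congr (_ * _%:R).
congr nat_of_bool; apply/eqP/forallP => [-> j|h]; first by rewrite ffunE.
by apply/ffunP=> j; rewrite ffunE; apply/eqP.
Qed.

(* Union is componentwise. *)
Lemma tpU_tens (u v : 'I_m -> PS R k) :
  tpU (tens u) (tens v) = tens (fun j => psU (u j) (v j)).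
Proof.
apply/ffunP=> c; rewrite tpUE ffunE.
under [RHS]eq_bigr => j _ do rewrite sum_ffunE.
rewrite bigA_distr_bigA /=; apply: eq_bigr => a _.
under [RHS]eq_bigr => j _ do rewrite sum_ffunE.
rewrite bigA_distr_bigA /=; apply: eq_bigr => b _.
under [RHS]eq_bigr => j _ do rewrite !ffunE.
rewrite !big_split /= !ffunE; congr (_ * _).
case: forallP => [h|h]; first by rewrite big1 // => j _; rewrite h.
suff [j nj] : exists j, c j != a j :|: b j.
  by rewrite (bigD1 j) //= (negPf nj) mul0r.
apply/existsP; apply: contra_notT h; rewrite negb_exists => /forallP h j.
by have := h j; rewrite negbK.
Qed.

Lemma tact_tens t (u : 'I_m -> PS R k) :
  tact t (tens u) = tens (fun j => u (t^-1 j)%g).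
Proof.
apply/ffunP=> a; rewrite !ffunE [RHS](reindex_inj (@perm_inj _ t)) /=.
by apply: eq_bigr => j _; rewrite ffunE permK.
Qed.

Lemma tact_is_linear t : linear (tact t).
Proof. by move=> c u v; apply/ffunP=> a; rewrite !ffunE. Qed.
HB.instance Definition _ t :=
  GRing.isLinear.Build R TP TP *:%R (tact t) (tact_is_linear t).

Lemma tactM s t v : tact s (tact t v) = tact (t * s)%g v.
Proof.
by apply/ffunP=> a; rewrite !ffunE; congr (v _); apply/ffunP=> j; rewrite !ffunE permM.
Qed.

Lemma tact1 v : tact 1%g v = v.
Proof.
by apply/ffunP=> a; rewrite !ffunE; congr (v _); apply/ffunP=> j; rewrite !ffunE perm1.
Qed.

Lemma tpUDl u u' v : tpU (u + u') v = tpU u v + tpU u' v.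
Proof.
apply/ffunP=> c; rewrite ffunE !tpUE -big_split; apply: eq_bigr => a _ /=.
by rewrite -big_split; apply: eq_bigr => b _ /=; rewrite ffunE !mulrDl.
Qed.

Lemma tpUDr u v v' : tpU u (v + v') = tpU u v + tpU u v'.
Proof.
apply/ffunP=> c; rewrite ffunE !tpUE -big_split; apply: eq_bigr => a _ /=.
by rewrite -big_split; apply: eq_bigr => b _ /=; rewrite ffunE mulrDr !mulrDl.
Qed.

Lemma tact_tpU t u v : tact t (tpU u v) = tpU (tact t u) (tact t v).
Proof.
pose h (a : tidx) : tidx := [ffun j => a (t^-1 j)%g].
pose g (a : tidx) : tidx := [ffun j => a (t j)].
have hK : cancel h g by move=> a; apply/ffunP=> j; rewrite !ffunE permK.
have h_inj := can_inj hK.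
apply/ffunP=> c; rewrite ffunE !tpUE [RHS](reindex_inj h_inj) /=.
apply: eq_bigr => a _; rewrite [RHS](reindex_inj h_inj) /=; apply: eq_bigr => b _.
rewrite !ffunE -/(g (h a)) -/(g (h b)) !hK; congr (_ * (nat_of_bool _)%:R).
apply/forallP/forallP => H j.
  by have := H (t^-1 j)%g; rewrite !ffunE permKV.
by have := H (t j); rewrite !ffunE permK.
Qed.

(* The span of the vectors [tact t v - v]; see [symker_mem], [symker_min]. *)
Definition symker : {vspace TP} :=
  (\sum_(t : 'S_m) limg (linfun (tact t) - \1%VF))%VS.

Lemma symker_mem t v : tact t v - v \in symker.
Proof.
apply: (subvP (sumv_sup t (erefl _) (subvv _))).
apply/memv_imgP; exists v; first exact: memvf.
by rewrite add_lfunE opp_lfunE lfunE /= id_lfunE.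
Qed.

Lemma symkerP v : v \in symker ->
  exists w : 'S_m -> TP, v = \sum_t (tact t (w t) - w t).
Proof.
case/memv_sumP=> vs vsP ->.
have H t : exists w, vs t == tact t w - w.
  have [w _ ->] := memv_imgP (vsP t isT).
  by exists w; rewrite add_lfunE opp_lfunE lfunE /= id_lfunE.
exists (fun t => xchoose (H t)); apply: eq_bigr => t _.
exact: (eqP (xchooseP (H t))).
Qed.

Lemma symker_min (W : {vspace TP}) :
  (forall t v, tact t v - v \in W) -> (symker <= W)%VS.
Proof.
move=> h; apply/subvP => v /symkerP[w ->].
by apply: rpred_sum => t _; apply: h.
Qed.

End TensorPower.

Section SymmetricPower.
Variables (R : realType) (m k : nat).
Local Notation TP := (TP R m k).

Definition SymPow := Quotient.quot (symker R m k).
HB.instance Definition _ := GRing.Zmodule.on SymPow.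

Definition spi (v : TP) : SymPow := \pi_(Quotient.quot (symker R m k)) v.
Definition srepr (x : SymPow) : TP := repr x.

Lemma sreprK x : spi (srepr x) = x. Proof. exact: reprK. Qed.

Lemma spi_eq u v : (spi u == spi v) = (u - v \in symker R m k).
Proof. by rewrite Quotient.idealrBE. Qed.

Lemma spi_is_additive : zmod_morphism spi.
Proof. exact: raddfB. Qed.
HB.instance Definition _ := GRing.isZmodMorphism.Build TP SymPow spi spi_is_additive.

Definition sscale (c : R) (x : SymPow) : SymPow := spi (c *: srepr x).

Lemma spiZ c v : spi (c *: v) = sscale c (spi v).
Proof.
by apply/eqP; rewrite spi_eq -scalerBr rpredZ // -spi_eq sreprK.
Qed.

Lemma sscaleA a b x : sscale a (sscale b x) = sscale (a * b) x.
Proof. by rewrite -[x]sreprK -!spiZ scalerA. Qed.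

Lemma sscale1 : left_id 1 sscale.
Proof. by move=> x; rewrite -[x]sreprK -spiZ scale1r. Qed.

Lemma sscaleDr : right_distributive sscale +%R.
Proof.
move=> a x y; rewrite -[x]sreprK -[y]sreprK -raddfD -!spiZ -raddfD.
by rewrite scalerDr.
Qed.

Lemma sscaleDl x : {morph sscale^~ x : a b / a + b}.
Proof. by move=> a b; rewrite -[x]sreprK -!spiZ scalerDl raddfD. Qed.

HB.instance Definition _ :=
  GRing.Zmodule_isLmodule.Build R SymPow sscaleA sscale1 sscaleDr sscaleDl.

Lemma spi_is_scalable : scalable spi.
Proof. by move=> c v; rewrite spiZ. Qed.
HB.instance Definition _ := GRing.isScalable.Build R TP SymPow *:%R spi spi_is_scalable.

(* {a_1, ..., a_m} *)
Definition scls (a : 'I_m -> {set 'I_k}) : SymPow := spi (tens (fun j => psb R (a j))).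

(* Independent of the representatives, by [symU_spi]. *)
Definition symU (x y : SymPow) : SymPow :=
  (m`!%:R)^-1 *: \sum_(t : 'S_m) spi (tpU (srepr x) (tact t (srepr y))).

(* The value on the empty sequence is irrelevant. *)
Definition symUs (s : seq SymPow) : SymPow :=
  if s is x :: s' then foldl symU x s' else 0.

Lemma spi_tact t v : spi (tact t v) = spi v.
Proof. by apply/eqP; rewrite spi_eq symker_mem. Qed.

Let N u v : SymPow := \sum_(t : 'S_m) spi (tpU u (tact t v)).

Let NDl u u' v : N (u + u') v = N u v + N u' v.
Proof. by rewrite /N -big_split; apply: eq_bigr => t _; rewrite tpUDl raddfD. Qed.

Let NDr u v v' : N u (v + v') = N u v + N u v'.
Proof. by rewrite /N -big_split; apply: eq_bigr => t _; rewrite raddfD tpUDr raddfD. Qed.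

Let N_tactl s u v : N (tact s u) v = N u v.
Proof.
rewrite /N [LHS](reindex_inj (mulIg s)) /=; apply: eq_bigr => t _.
by rewrite -tactM -tact_tpU spi_tact.
Qed.

Let N_tactr s u v : N u (tact s v) = N u v.
Proof.
rewrite /N [RHS](reindex_inj (mulgI s)) /=; apply: eq_bigr => t _.
by rewrite tactM.
Qed.

Let N_eq u u' v v' : spi u = spi u' -> spi v = spi v' -> N u v = N u' v'.
Proof.
move=> /eqP; rewrite spi_eq => /symkerP[w /eqP]; rewrite subr_eq => /eqP -> {u}.
move=> /eqP; rewrite spi_eq => /symkerP[z /eqP]; rewrite subr_eq => /eqP -> {v}.
have N0l y : N 0 y = 0 by apply: (addIr (N 0 y)); rewrite -NDl !add0r.
have N0r x : N x 0 = 0 by apply: (addIr (N x 0)); rewrite -NDr !add0r.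
have NBl x x' y : N (x - x') y = N x y - N x' y.
  by apply/eqP; rewrite eq_sym subr_eq -NDl subrK.
have NBr x y y' : N x (y - y') = N x y - N x y'.
  by apply/eqP; rewrite eq_sym subr_eq -NDr subrK.
have Nl y : N (\sum_t (tact t (w t) - w t)) y = 0.
  rewrite (big_morph (N^~ y) (fun a b => NDl a b y) (N0l y)) big1 // => t _.
  by rewrite NBl N_tactl subrr.
have Nr x : N x (\sum_t (tact t (z t) - z t)) = 0.
  rewrite (big_morph (N x) (NDr x) (N0r x)) big1 // => t _.
  by rewrite NBr N_tactr subrr.
by rewrite NDl Nl add0r NDr Nr add0r.
Qed.

Lemma symU_spi u v :
  symU (spi u) (spi v) = (m`!%:R)^-1 *: \sum_(t : 'S_m) spi (tpU u (tact t v)).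
Proof. by congr (_ *: _); apply: N_eq; rewrite sreprK. Qed.

End SymmetricPower.

(* Main.v *)
(** The union of Sym^m is bilinear, and the union of two classes of basis
    tensors is the average over t of {a_j :|: b_(t j)}: the inverse introduced
    by the action on pure tensors is absorbed by reindexing over S_m.  Folding
    from the left, each new factor contributes one more average over S_m, while
    the first factor is never permuted. *)

From HB Require Import structures.
Require Import Defs.
From mathcomp Require Import all_boot all_order all_fingroup all_algebra.
From mathcomp Require Import reals.

Import GRing.Theory.
Local Open Scope ring_scope.

Section FfunCons.
Variables (T : finType) (n : nat).

Definition ffun_cons (x : T) (s : {ffun 'I_n -> T}) : {ffun 'I_n.+1 -> T} :=
  [ffun i => if unlift ord0 i is Some j then s j else x].

Lemma ffun_cons0 x s : ffun_cons x s ord0 = x.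
Proof. by rewrite ffunE unlift_none. Qed.

Lemma ffun_consS x s j : ffun_cons x s (lift ord0 j) = s j.
Proof. by rewrite ffunE liftK. Qed.

(** [ffun_cons] is a bijection from pairs (head, tail), inverted by evaluation at [ord0] and at the
    lifts. It serves to isolate the permutation attached to a single factor. *)
Lemma sum_ffun_recl (V : nmodType) (F : {ffun 'I_n.+1 -> T} -> V) :
  \sum_s F s = \sum_x \sum_s F (ffun_cons x s).
Proof.
rewrite (pair_bigA _ (fun x s => F (ffun_cons x s))) /=.
rewrite (reindex (fun p : T * {ffun 'I_n -> T} => ffun_cons p.1 p.2)) //=.
exists (fun s => (s ord0, [ffun j => s (lift ord0 j)])) => [[x s] _|s _] /=.
  rewrite ffun_cons0; congr pair; apply/ffunP=> j.
  by rewrite [LHS]ffunE ffun_consS.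
apply/ffunP=> i; case: (unliftP ord0 i) => [j|] ->.
  by rewrite ffun_consS ffunE.
by rewrite ffun_cons0.
Qed.

End FfunCons.

Arguments ffun_cons {T n}.

Section UnionOfClasses.
Variables (R : realType) (m k : nat).

Lemma tpUZl (c : R) (u v : TP R m k) : tpU (c *: u) v = c *: tpU u v.
Proof.
rewrite /tpU scaler_sumr; apply: eq_bigr => a _.
rewrite scaler_sumr; apply: eq_bigr => b _.
by rewrite ffunE scalerA mulrA.
Qed.

(** By [symU_spi] any representatives may be used, so [c *: x + x'] can be represented by the same
    combination of representatives; [tpU] is linear in its left argument. *)
Lemma symU_linearl (y : SymPow R m k) : linear (fun x => symU x y).
Proof.
move=> c x x'; rewrite -[x]sreprK -[x']sreprK -[y]sreprK -linearP !symU_spi.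
rewrite scalerA mulrC -scalerA -scalerDr; congr (_ *: _).
rewrite scaler_sumr -big_split; apply: eq_bigr => t _ /=.
by rewrite tpUDl tpUZl linearP.
Qed.

Lemma foldl_symU_linear (l : seq (SymPow R m k)) :
  linear (fun x => foldl (@symU R m k) x l).
Proof. by elim: l => [|y l IHl] c x x' //=; rewrite symU_linearl IHl. Qed.

Lemma foldl_symU_scale_sum (I : finType) (c : R) (x : I -> SymPow R m k) l :
  foldl (@symU R m k) (c *: \sum_i x i) l =
  c *: \sum_i foldl (@symU R m k) (x i) l.
Proof.
(* The fold is packed as a linear map so that the generic lemmas on scaling and sums apply to it. *)
pose f := GRing.isLinear.Build R _ _ _ _ (foldl_symU_linear l).
pose F : {linear SymPow R m k -> SymPow R m k} :=
  HB.pack (fun x => foldl (@symU R m k) x l) f.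
by rewrite -[LHS]/(F _) linearZ linear_sum.
Qed.

Lemma eq_scls (a b : 'I_m -> {set 'I_k}) : a =1 b -> scls R a = scls R b.
Proof.
move=> eq_ab; congr spi; apply/ffunP=> c; rewrite !ffunE.
by apply: eq_bigr => j _; rewrite eq_ab.
Qed.

Lemma psU_psb (a b : {set 'I_k}) : psU (psb R a) (psb R b) = psb R (a :|: b).
Proof.
rewrite /psU (bigD1 a) //= (bigD1 b) //= !ffunE !eqxx mulr1 scale1r.
rewrite big1 ?addr0 => [|c /negPf nc]; last by rewrite !ffunE nc mulr0 scale0r.
rewrite big1 ?addr0 // => c /negPf nc.
by rewrite big1 // => d _; rewrite !ffunE nc mul0r scale0r.
Qed.

Lemma symU_scls (a b : 'I_m -> {set 'I_k}) :
  symU (scls R a) (scls R b) =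
  (m`!%:R)^-1 *: \sum_(t : 'S_m) scls R (fun j => a j :|: b (t j)).
Proof.
rewrite symU_spi; congr (_ *: _).
rewrite (reindex_inj (@invg_inj _)) /=; apply: eq_bigr => t _.
rewrite tact_tens tpU_tens invgK; congr spi; apply/ffunP=> c; rewrite !ffunE.
by apply: eq_bigr => j _; rewrite psU_psb.
Qed.

(** The accumulator [b] is kept arbitrary for the induction: after one union it becomes
    [b j :|: a ord0 (t j)], again a class of basis tensors, for each [t] in the average. *)
Lemma foldl_symU_scls n (b : 'I_m -> {set 'I_k}) (a : 'I_n -> 'I_m -> {set 'I_k}) :
  foldl (@symU R m k) (scls R b) [seq scls R (a i) | i <- enum 'I_n] =
  (m`!%:R ^+ n)^-1 *:
    \sum_(s : {ffun 'I_n -> 'S_m})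
      scls R (fun j => b j :|: \bigcup_(i < n) a i (s i j)).
Proof.
elim: n => [|n IHn] in b a *.
  (* There is exactly one function out of the empty type ['I_0], so the sum has a single term. *)
  rewrite enum_ord0 expr0 invr1 scale1r (big_pred1 [ffun => 1%g]) /= => [|s].
    by apply: eq_scls => j; rewrite big_ord0 setU0.
  by apply/esym/eqP/ffunP=> -[].
(* Linearity moves the average over [t] out of the remaining fold; [t] then becomes the head of the
   family [s], and its factor [m!] raises the exponent by one. *)
rewrite enum_ordSl /= -map_comp symU_scls foldl_symU_scale_sum.
rewrite sum_ffun_recl exprS invfM -scalerA; congr (_ *: _); rewrite scaler_sumr.
apply: eq_bigr => t _; rewrite (IHn _ (fun i => a (lift ord0 i))).
congr (_ *: _); apply: eq_bigr => s _; apply: eq_scls => j.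
rewrite big_ord_recl ffun_cons0 setUA; congr (_ :|: _).
by apply: eq_bigr => i _; rewrite ffun_consS.
Qed.

End UnionOfClasses.

Theorem theorem4p1 (R : realType) (k m n : nat)
  (hk : (0 < k)%N) (hm : (0 < m)%N) (hn : (0 < n)%N)
  (a : 'I_n -> 'I_m -> {set 'I_k}) :
  symUs [seq scls R (a i) | i <- enum 'I_n] =
  (m`!%:R ^+ n.-1)^-1 *:
    \sum_(s : {ffun 'I_n -> 'S_m} | s (Ordinal hn) == 1%g)
      scls R (fun j : 'I_m => \bigcup_(i < n) a i (s i j)).
Proof.
case: n => [//|n] in hn a *.
have -> : Ordinal hn = ord0 by apply: val_inj.
rewrite enum_ordSl /= -map_comp.
rewrite (foldl_symU_scls _ _ _ n _ (fun i => a (lift ord0 i))); congr (_ *: _).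
(* With the constraint turned into a conditional summand and the head split off, only the head [1%g]
   contributes; the tails index the sum from the fold. *)
rewrite [RHS]big_mkcond [RHS]sum_ffun_recl [RHS](bigD1 1%g) //= [X in _ + X]big1 ?addr0.
  apply: eq_bigr => s _; rewrite ffun_cons0 eqxx; apply: eq_scls => j.
  rewrite big_ord_recl ffun_cons0 perm1; congr (_ :|: _).
  by apply: eq_bigr => i _; rewrite ffun_consS.
by move=> t /negPf nt; rewrite big1 // => s _; rewrite ffun_cons0 nt.
Qed.
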